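(* Let $F$ be an $M\times N$ unit norm frame that satisfies the Strong Coherence Property, let $K$ be a positive integer and let $\delta>0$. If $N\geq128$ and $2K\log N\leq\min\big\{\frac{\delta^2}{100\mu_F^2},M\big\}$, then $F$ satisfies the $(K,\delta,\frac{4K}{N^2})$-Weak Restricted Isometry Property.
   Context: $\log$ is the natural logarithm. An $M\times N$ unit norm frame is a complex $M\times N$ matrix of rank $M$ whose columns $f_1,\ldots,f_N$ have Euclidean norm $1$. The worst-case coherence is $\mu_F:=\max_{i\neq j}|\langle f_i,f_j\rangle|$ and the average coherence is $\nu_F:=\frac{1}{N-1}\max_{i\in\{1,\ldots,N\}}\big|\sum_{j\neq i}\langle f_i,f_j\rangle\big|$, where $i,j$ range over $\{1,\ldots,N\}$. Strong Coherence Property: an $M\times N$ unit norm frame $F$ satisfies it if $\mu_F\leq\frac{1}{164\log N}$ and $\nu_F\leq\frac{\mu_F}{\sqrt{M}}$. Weak Restricted Isometry Property: an $M\times N$ frame $F$ satisfies the $(K,\delta,p)$-Weak Restricted Isometry Property if for every $K$-sparse vector $x\in\mathbb{C}^N$ (i.e., having at most $K$ nonzero entries), a (uniformly) random permutation $y$ of $x$'s entries satisfies $(1-\delta)\|y\|^2\leq\|Fy\|^2\leq(1+\delta)\|y\|^2$ with probability exceeding $1-p$. *)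

(* Defs.v *)
(* Real numbers: an arbitrary R : realType. Complex numbers: R[i]. *)
From mathcomp Require Import all_boot all_order all_algebra all_fingroup.
From mathcomp Require Import complex.
From mathcomp Require Import all_classical all_reals all_analysis.

Set Implicit Arguments.
Unset Strict Implicit.
Unset Printing Implicit Defensive.

Import Order.TTheory GRing.Theory Num.Theory.

Local Open Scope ring_scope.

Section Frames.
Variable R : realType.
Local Notation C := R[i].
Implicit Types (m n M N K : nat) (delta p : R).

(* <u, v> is linear in u and conjugate-linear in v; [dotmx] is the Hermitian
   product of row vectors. *)
Definition cinner m (u v : 'cV[C]_m) : C := dotmx u^T v^T.

(* [Normc.normc z] is the modulus of z as an element of R, whereas `|z| lives
   in R[i]. *)
Definition cmod (z : C) : R := Normc.normc z.

Definition l2norm m (v : 'cV[C]_m) : R := Num.sqrt (\sum_k cmod (v k 0) ^+ 2).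

Definition unit_norm_frame M N (F : 'M[C]_(M, N)) : Prop :=
  \rank F = M /\ forall i : 'I_N, l2norm (col i F) = 1.

(* The default value 0 of the maxima below is harmless: moduli are
   nonnegative. *)
Definition worst_case_coherence M N (F : 'M[C]_(M, N)) : R :=
  \big[Num.max/0]_(ij : 'I_N * 'I_N | ij.1 != ij.2)
     cmod (cinner (col ij.1 F) (col ij.2 F)).

Definition average_coherence M N (F : 'M[C]_(M, N)) : R :=
  (N%:R - 1)^-1 *
  \big[Num.max/0]_(i < N)
     cmod (\sum_(j < N | j != i) cinner (col i F) (col j F)).

Definition strong_coherence_property M N (F : 'M[C]_(M, N)) : Prop :=
  worst_case_coherence F <= 1 / (164 * ln N%:R) /\
  average_coherence F <= worst_case_coherence F / Num.sqrt M%:R.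

Definition sparse N K (x : 'cV[C]_N) : bool :=
  (#|[set i : 'I_N | (x i 0 != 0)%R]| <= K)%N.

Definition uniform_perm_prob N (A : {set 'S_N}) : R :=
  #|A|%:R / #|[set: 'S_N]|%:R.

(* [row_perm s x] is the column vector with entries x (s i). *)
Definition weak_RIP M N (K : nat) delta p (F : 'M[C]_(M, N)) : Prop :=
  forall x : 'cV[C]_N, sparse K x ->
    1 - p < uniform_perm_prob
      [set s : 'S_N |
        let y := row_perm s x in
        (1 - delta) * l2norm y ^+ 2 <= l2norm (F *m y) ^+ 2
          <= (1 + delta) * l2norm y ^+ 2].

End Frames.

(* Main.v *)
(* With t the inverse of the random permutation, ||Fy||^2 - ||y||^2 is the sum
   over i of conj(x_i) S_i, where S_i = sum_(j != i) x_j <f_(t j), f_(t i)>, so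
   by Cauchy-Schwarz it suffices that sqrt K |S_i| <= delta ||x|| for every i in
   the support of x; each i contributes at most 4 / N^2 to the union bound.
   Given t i, the mean of S_i is controlled by the average coherence, and the
   fluctuations are sub-Gaussian with variance of order mu_F^2 ||x||^2. *)
Require Import Defs.
From mathcomp Require Import all_boot all_order all_algebra all_fingroup.
From mathcomp Require Import complex.
From mathcomp Require Import all_classical all_reals all_analysis.
From mathcomp Require Import unstable ring lra.

Set Implicit Arguments.
Unset Strict Implicit.
Unset Printing Implicit Defensive.

Import Order.TTheory GRing.Theory Num.Theory.

Local Open Scope ring_scope.

(** * Elementary exponential inequalities *)

Lemma expR_le_inv1B (R : realType) (x : R) : x < 1 -> expR x <= (1 - x)^-1.
Proof.
move=> x1; rewrite -[expR x]invrK -expRN lef_pV2 ?posrE ?expR_gt0 ?subr_gt0 //.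
exact: expR_ge1Dx.
Qed.

(** A weak form of cosh x <= exp(x^2 / 2) with an elementary proof: for |x| <= 1/2 the two
    exponentials are at most 1 / (1 - x) and 1 / (1 + x), and otherwise |x| <= 2 x^2. *)
Lemma expRD_expRN_le (R : realType) (x : R) :
  expR x + expR (- x) <= 2 * expR (2 * x ^+ 2).
Proof.
have [x2|x2] := leP `|x| (1 / 2).
  have /andP[xl xr] : - (1 / 2) <= x <= 1 / 2 by rewrite -ler_norml.
  have e1 : expR x <= (1 - x)^-1 by apply: expR_le_inv1B; lra.
  have e2 : expR (- x) <= (1 + x)^-1.
    by rewrite -[X in 1 + X]opprK; apply: expR_le_inv1B; lra.
  have e3 : 1 + 2 * x ^+ 2 <= expR (2 * x ^+ 2) by exact: expR_ge1Dx.
  have x4 : x ^+ 2 <= 1 / 4 by nra.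
  apply: (le_trans (lerD e1 e2)); apply: (@le_trans _ _ (2 * (1 + 2 * x ^+ 2))).
    have -> : (1 - x)^-1 + (1 + x)^-1 = 2 / (1 - x ^+ 2) by field; nra.
    rewrite ler_pdivrMr; last by nra.
    nra.
  by rewrite ler_pM2l.
have x0 : `|x| <= 2 * x ^+ 2 by rewrite -(real_normK (num_real x)); nra.
have h (y : R) : `|y| = `|x| -> expR y <= expR (2 * x ^+ 2).
  by move=> yx; rewrite ler_expR (le_trans _ x0) // -yx ler_norm.
have := lerD (h x erefl) (h (- x) (normrN x)); lra.
Qed.

(** Numerically, e^4 = (e^(1/4))^16 <= (4/3)^16 < 100. *)
Lemma ln128_ge4 (R : realType) : 4 <= ln (128 : R).
Proof.
rewrite -ler_expR lnK ?posrE //.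
have -> : (4 : R) = 16 * 4^-1 by field.
rewrite expRM_natl.
have e1 : expR (4^-1 : R) <= 4 / 3.
  have -> : 4 / 3 = (1 - 4^-1)^-1 :> R by field.
  by apply: expR_le_inv1B; lra.
apply: (@le_trans _ _ ((4 / 3) ^+ 16)).
  by rewrite lerXn2r // ?nnegrE ?expR_ge0 //; lra.
by lra.
Qed.

(* Symmetrisation: with an independent copy b' of b, Jensen bounds
   E exp(u b - E u) by E exp(u b - u b'), and the latter is an average of
   hyperbolic cosines. *)
Lemma sum_expR_le (R : realType) (T : finType) (B : {set T}) (u : T -> R) (c : R) :
  (0 < #|B|)%N ->
  {in B &, forall b b', `|u b - u b'| <= c} ->
  \sum_(b in B) expR (u b) <=
    #|B|%:R * expR ((\sum_(b in B) u b) / #|B|%:R + 2 * c ^+ 2).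
Proof.
move=> B0 uc; set n : R := #|B|%:R; set m := (\sum_(b in B) u b) / n.
have n0 : 0 < n by rewrite ltr0n.
set S := \sum_(b in B) expR (u b); set S' := \sum_(b in B) expR (- u b).
(* Jensen through the tangent line of exp at -m; the linear terms cancel because m is the mean. *)
have jensen : n * expR (- m) <= S'.
  have -> : n * expR (- m) = \sum_(b in B) expR (- m) * (1 + (m - u b)).
    rewrite -mulr_sumr big_split /= sumr_const sumrB sumr_const -mulr_natr.
    rewrite -[m *+ _]mulr_natr -/n /m mul1r divfK ?gt_eqF // subrr addr0.
    by rewrite mulrC.
  apply: ler_sum => b _.
  have -> : expR (- u b) = expR (- m + (m - u b)) by congr expR; ring.
  by rewrite expRD ler_pM2l ?expR_gt0 // expR_ge1Dx.
have sym : S * S' <= n * n * expR (2 * c ^+ 2).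
  have SS : S * S' = \sum_(b in B) \sum_(b' in B) expR (u b - u b').
    rewrite mulr_suml; apply: eq_bigr => b _; rewrite mulr_sumr.
    by apply: eq_bigr => b' _; rewrite expRD.
  have SS2 : S * S' = \sum_(b in B) \sum_(b' in B) expR (- (u b - u b')).
    rewrite SS exchange_big; apply: eq_bigr => b _; apply: eq_bigr => b' _.
    by rewrite opprB.
  (* Twice the product is written with both orders of (b, b'), so that each pair contributes exp d +
     exp(-d) with |d| <= c. *)
  rewrite -(@ler_pM2l _ 2) // [leLHS]mulrDl mul1r {1}SS SS2 -big_split /=.
  apply: (@le_trans _ _ (\sum_(b in B) \sum_(b' in B) 2 * expR (2 * c ^+ 2))).
    apply: ler_sum => b bB; rewrite -big_split /=; apply: ler_sum => b' b'B.
    apply: le_trans (expRD_expRN_le _) _; rewrite ler_pM2l // ler_expR ler_pM2l //.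
    rewrite -real_normK ?num_real // lerXn2r ?nnegrE ?uc //.
    exact: le_trans (uc _ _ bB b'B).
  by rewrite !sumr_const -mulrnA -[X in X <= _]mulr_natr natrM -/n; lra.
rewrite -(@ler_pM2r _ (n * expR (- m))) ?mulr_gt0 ?expR_gt0 //.
apply: (@le_trans _ _ (S * S')).
  by rewrite ler_wpM2l // sumr_ge0 // => b _; exact: expR_ge0.
apply: (le_trans sym).
rewrite [X in _ <= X]mulrACA -expRD.
by rewrite ler_pM2l ?mulr_gt0 // ler_expR; lra.
Qed.

(** * Exponential moments of sums along a random permutation *)

(** Left multiplication by a transposition is a bijection of the group. It replaces s j by s b, so
    the inner sum plays the role of resampling the value at j. *)
Lemma sum_perm_tperm (R : realType) (T : finType) (B : {set T}) (j : T)
    (f : {perm T} -> R) :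
  #|B|%:R * \sum_s f s = \sum_s \sum_(b in B) f (tperm j b * s)%g.
Proof.
rewrite exchange_big /=; rewrite mulr_natl -sumr_const; apply: eq_bigr => b _.
by rewrite [LHS](reindex_inj (mulgI (tperm j b))).
Qed.

(** The gap is (a - b)^2 / n. The weight (n + 1) / n is the one that turns the factor 1 / (n + 1) of
    the induction hypothesis into 1 / n. *)
Lemma sqrrD_le (R : realFieldType) (n a b : R) : 0 < n ->
  (a + b / n) ^+ 2 <= (n + 1) / n * a ^+ 2 + (n + 1) / n ^+ 2 * b ^+ 2.
Proof.
move=> n0; rewrite -subr_ge0.
have -> : (n + 1) / n * a ^+ 2 + (n + 1) / n ^+ 2 * b ^+ 2 - (a + b / n) ^+ 2
  = n^-1 * (a - b) ^+ 2 by field; rewrite gt_eqF.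
by rewrite mulr_ge0 ?sqr_ge0 // invr_ge0 ltW.
Qed.

(* Induction on js: conditioning on the values at i0 :: js', the value at the
   first position j is uniform over the n remaining ones. As h j is centered, its
   conditional mean is - (\sum_(k <- js') h j (s i0) (s k)) / n, which is
   absorbed by replacing h k with h k - h j / n; this preserves centering. *)
Lemma perm_mgf_le (R : realType) (T : finType) (i0 : T) (js : seq T)
    (h : T -> T -> T -> R) (c : T -> R) :
  uniq (i0 :: js) -> (8 * size js <= #|T|)%N -> (forall j, 0 <= c j) ->
  (forall j a, \sum_(l | l != a) h j a l = 0) ->
  (forall j a l l', l != a -> l' != a -> `|h j a l - h j a l'| <= c j) ->
  \sum_(s : {perm T}) expR (\sum_(j <- js) h j (s i0) (s j)) <=
    #|{perm T}|%:R *
    expR (17 / 8 * (#|T|%:R / (#|T| - size js)%:R) * \sum_(j <- js) c j ^+ 2).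
Proof.
elim: js h c => [|j js IH] h c; first move=> _ _ _ _ _.
  under eq_bigr do rewrite big_nil expR0.
  by rewrite sumr_const big_nil mulr0 expR0 mulr1.
move=> /= /and3P[]; rewrite inE negb_or => /andP[i0j i0js] jjs ujs size8 c0 h0 hc.
(* The positions whose values remain free once those on i0 :: js are fixed; j is one of them. *)
set B := [set b | b \notin i0 :: js].
have cardB : #|B| = (#|T| - (size js).+1)%N.
  have := cardC (mem (i0 :: js)).
  have /card_uniqP -> : uniq (i0 :: js) by rewrite /= i0js.
  by rewrite cardsE /= => <-; rewrite addKn; apply: eq_card.
have ltT : ((size js).+1 <= #|T|)%N by apply: leq_trans size8; rewrite leq_pmull.
have B0 : (0 < #|B|)%N.
  rewrite cardB subn_gt0; apply: leq_trans size8.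
  by rewrite -[X in (X < _)%N]mul1n ltn_mul2r.
set n : R := (#|T| - (size js).+1)%:R.
have n0 : 0 < n by rewrite /n -cardB ltr0n.
set h' := fun k a l => h k a l - h j a l / n.
set c' := fun k => c k + c j / n.
(* The positions other than i0 split into [B] and [js], and the sum over all of them vanishes by
   centering. *)
have sumB (s : {perm T}) :
    \sum_(b in B) h j (s i0) (s b) = - \sum_(k <- js) h j (s i0) (s k).
  apply/eqP; rewrite -addr_eq0; apply/eqP; apply: etrans (h0 j (s i0)).
  rewrite [RHS](reindex_inj (@perm_inj _ s)) /= [RHS](bigID (mem js)) /= addrC.
  congr (_ + _); last rewrite big_uniq //=; apply: eq_bigl => b.
    by rewrite inE in_cons negb_or (inj_eq perm_inj).
  by rewrite (inj_eq perm_inj); case: eqP => // ->; exact/negbTE.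
have step : \sum_(s : {perm T}) expR (\sum_(k <- j :: js) h k (s i0) (s k)) <=
    expR (2 * c j ^+ 2) *
    \sum_(s : {perm T}) expR (\sum_(k <- js) h' k (s i0) (s k)).
  (* Average over the swaps of j with b in [B]: the values at i0 and on [js] stay put, while the
     value at j runs over the free ones. *)
  rewrite -(ler_pM2l n0) {1}/n -cardB (sum_perm_tperm B j) mulrA mulr_sumr.
  apply: ler_sum => s _.
  have fixed k : k \in i0 :: js -> forall b, b \in B -> (tperm j b * s)%g k = s k.
    move=> kjs b; rewrite inE => bB; rewrite permM tpermD //.
      by apply: contraNneq jjs => jk; move: kjs; rewrite -jk inE eq_sym (negbTE i0j).
    by apply: contraNneq bB => ->.
  set r := \sum_(k <- js) h k (s i0) (s k).
  have -> : \sum_(b in B) expR (\sum_(k <- j :: js)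
      h k ((tperm j b * s)%g i0) ((tperm j b * s)%g k)) =
      expR r * \sum_(b in B) expR (h j (s i0) (s b)).
    rewrite mulr_sumr; apply: eq_bigr => b bB.
    rewrite big_cons (fixed i0 (mem_head _ _) b bB) permM tpermL -expRD addrC.
    congr expR; congr (_ + _).
    by apply: eq_big_seq => k kjs; rewrite fixed // inE kjs orbT.
  apply: (@le_trans _ _ (expR r * (#|B|%:R * expR
    ((\sum_(b in B) h j (s i0) (s b)) / #|B|%:R + 2 * c j ^+ 2)))).
    rewrite ler_pM2l ?expR_gt0 //; apply: sum_expR_le => // b b'.
    rewrite !inE !negb_or => /andP[bi0 _] /andP[b'i0 _].
    by apply: hc; rewrite (inj_eq perm_inj).
  rewrite cardB -/n sumB mulrCA -!mulrA ler_pM2l // -!expRD ler_expR /h' sumrB.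
  by rewrite -mulr_suml -/r; lra.
apply: (le_trans step).
have := IH h' c'; rewrite /= ujs i0js => /(_ isT) IH'.
have {IH'} : \sum_(s : {perm T}) expR (\sum_(k <- js) h' k (s i0) (s k)) <=
    #|{perm T}|%:R * expR (17 / 8 * (#|T|%:R / (#|T| - size js)%:R) *
                           \sum_(k <- js) c' k ^+ 2).
  apply: IH'.
  - by apply: leq_trans size8; rewrite leq_mul2l leqnSn.
  - by move=> k; rewrite addr_ge0 ?divr_ge0 ?(ltW n0).
  - by move=> k a; rewrite sumrB -mulr_suml !h0 mul0r subr0.
  move=> k a l l' la l'a; rewrite /h' /c'.
  have -> : h k a l - h j a l / n - (h k a l' - h j a l' / n) =
    (h k a l - h k a l') - (h j a l - h j a l') / n by ring.
  rewrite (le_trans (ler_normB _ _)) // lerD ?hc // normrM normfV (gtr0_norm n0).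
  by rewrite ler_pM2r ?invr_gt0 // hc.
rewrite -(ler_pM2l (expR_gt0 (2 * c j ^+ 2))) => /le_trans; apply.
rewrite mulrCA ler_wpM2l // -expRD ler_expR big_cons.
set Q := \sum_(k <- js) c k ^+ 2.
have Q'_le : \sum_(k <- js) c' k ^+ 2 <=
    (n + 1) / n * Q + (size js)%:R * ((n + 1) / n ^+ 2 * c j ^+ 2).
  apply: (@le_trans _ _ (\sum_(k <- js)
      ((n + 1) / n * c k ^+ 2 + (n + 1) / n ^+ 2 * c j ^+ 2))).
    by apply: ler_sum => k _; exact: sqrrD_le.
  rewrite big_split /= -mulr_sumr -/Q big_const_seq count_predT iter_addr_0.
  by rewrite mulr_natl.
set D : R := #|T|%:R; set q : R := (size js)%:R in Q'_le *.
have nE : n = D - q - 1.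
  by rewrite /n natrB // -natr1 /D /q; ring.
have -> : (#|T| - size js)%:R = n + 1 :> R.
  by rewrite nE natrB ?(ltnW ltT) // /D /q; ring.
have q0 : 0 <= q by rewrite ler0n.
have qD : 8 * (q + 1) <= D by rewrite natr1 -natrM ler_nat.
apply: (@le_trans _ _ (2 * c j ^+ 2 + 17 / 8 * (D / (n + 1)) *
    ((n + 1) / n * Q + q * ((n + 1) / n ^+ 2 * c j ^+ 2)))).
  by rewrite lerD2l ler_wpM2l // mulr_ge0 // divr_ge0 ?ler0n //; lra.
(* The Q terms cancel exactly. The excess of 17/8 over 2, together with D >= 8 (q + 1), absorbs the
   additional multiples of c j ^ 2. *)
rewrite -subr_ge0.
have -> : 17 / 8 * (D / n) * (c j ^+ 2 + Q) - (2 * c j ^+ 2 + 17 / 8 * (D / (n + 1)) *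
    ((n + 1) / n * Q + q * ((n + 1) / n ^+ 2 * c j ^+ 2))) =
    c j ^+ 2 / (8 * n ^+ 2) * (17 * D * n - 16 * n ^+ 2 - 17 * D * q).
  by field; rewrite !gt_eqF //; lra.
rewrite mulr_ge0 ?divr_ge0 ?mulr_ge0 ?sqr_ge0 //.
by rewrite nE; nra.
Qed.

(** * The complex modulus *)

Section Modulus.
Variable R : realType.
Local Notation C := R[i].
Implicit Types z w : C.

Lemma cmod_ge0 z : 0 <= cmod z.
Proof. by case: z => a b; exact: sqrtr_ge0. Qed.

Lemma sqr_cmod z : cmod z ^+ 2 = complex.Re z ^+ 2 + complex.Im z ^+ 2.
Proof. by case: z => a b; rewrite sqr_sqrtr // addr_ge0 ?sqr_ge0. Qed.

Lemma cmodJ z : cmod (conjc z) = cmod z.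
Proof. by case: z => a b; rewrite /cmod /= sqrrN. Qed.

Lemma mulcJ z : z * conjc z = (cmod z ^+ 2)%:C%C.
Proof.
rewrite -sqr_normc normc_def -sqr_cmod sqrtr_sqr.
by rewrite ger0_norm ?cmod_ge0 // rmorphXn.
Qed.

Lemma cmod_real (r : R) : cmod r%:C%C = `|r|.
Proof. by rewrite /cmod /= expr0n addr0 sqrtr_sqr. Qed.

Lemma cmodB_le z w : cmod (z - w) <= cmod z + cmod w.
Proof. by rewrite /cmod -(normcN w) le_normcD. Qed.

Lemma cmod_sum_le (I : Type) (r : seq I) (P : pred I) (f : I -> C) :
  cmod (\sum_(i <- r | P i) f i) <= \sum_(i <- r | P i) cmod (f i).
Proof.
elim/big_ind2 : _ => //; first by rewrite /cmod Normc.normc0.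
by move=> a b c d ab cd; rewrite (le_trans (le_normcD _ _)) // lerD.
Qed.

Lemma Re_le_cmod z : `|complex.Re z| <= cmod z.
Proof.
by rewrite -ler_sqr ?nnegrE ?cmod_ge0 // real_normK ?num_real // sqr_cmod lerDl sqr_ge0.
Qed.

Lemma ReB z w : complex.Re (z - w) = complex.Re z - complex.Re w.
Proof. by case: z w => [a b] [c d]. Qed.

Lemma Re_sum (I : Type) (r : seq I) (P : pred I) (f : I -> C) :
  complex.Re (\sum_(i <- r | P i) f i) = \sum_(i <- r | P i) complex.Re (f i).
Proof. by apply: (big_morph (@complex.Re R)) => // -[a b] [c d]. Qed.

(** If both coordinates of z were at most t / sqrt 2 in absolute value, then |z| <= t. This reduces
    a tail bound for a modulus to four tail bounds for real parts. *)
Lemma cmod_gt_rotate (t : R) z : 0 <= t -> t < cmod z ->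
  exists2 w, w \in [:: 1; -1; 'i%C; - 'i%C] & t / Num.sqrt 2 < complex.Re (w * z).
Proof.
move=> t0; have q0 : 0 < Num.sqrt 2 :> R by rewrite sqrtr_gt0.
rewrite -ltr_sqr ?nnegrE ?cmod_ge0 // sqr_cmod => tz.
set u := t / Num.sqrt 2.
have uE : t ^+ 2 = 2 * u ^+ 2 by rewrite exprMn exprVn sqr_sqrtr //; field.
have u0 : 0 <= u by rewrite divr_ge0 // ltW.
case: z tz => a b /=; rewrite uE => tz.
have [ua|au] := ltP u a; first by exists 1; rewrite ?inE ?eqxx // mul1r.
have [uNa|aNu] := ltP u (- a).
  by exists (-1); rewrite ?inE ?eqxx ?orbT // mulN1r.
have [ub|bu] := ltP u b.
  by exists (- 'i%C); rewrite ?inE ?eqxx ?orbT //=; lra.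
exists 'i%C; rewrite ?inE ?eqxx ?orbT //=.
by rewrite mul0r mul1r sub0r; nra.
Qed.

End Modulus.

(** Cauchy-Schwarz against the constant 1, from 2ab <= a^2 + b^2. *)
Lemma sqr_sum_le (R : realDomainType) (T : finType) (A : {set T}) (f : T -> R) :
  (\sum_(i in A) f i) ^+ 2 <= #|A|%:R * \sum_(i in A) f i ^+ 2.
Proof.
rewrite -(@ler_pM2l _ 2) // expr2 mulr_suml.
under eq_bigr do rewrite mulr_sumr.
apply: (@le_trans _ _ (\sum_(i in A) \sum_(j in A) (f i ^+ 2 + f j ^+ 2))).
  rewrite mulr_sumr; apply: ler_sum => i _; rewrite mulr_sumr; apply: ler_sum => j _.
  by rewrite -subr_ge0; have := sqr_ge0 (f i - f j); lra.
under eq_bigr do rewrite big_split /= sumr_const -[f _ ^+ 2 *+ _]mulr_natl.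
by rewrite big_split /= sumr_const -mulr_sumr -[_ *+ _]mulr_natl; lra.
Qed.

(** * Sub-Gaussian tail of a centered row sum *)

Section Tail.
Variables (R : realType) (T : finType) (i0 : T) (A : {set T}).
Variables (g : T -> T -> R[i]) (x : T -> R[i]) (mu V : R).
Hypotheses (i0A : i0 \notin A) (cardA : (8 * #|A| <= #|T|)%N) (T_gt1 : (1 < #|T|)%N).
Hypotheses (g_mu : forall a l, l != a -> cmod (g a l) <= mu).
Hypotheses (mu_gt0 : 0 < mu) (V_gt0 : 0 < V).
Hypothesis xV : \sum_(j in A) cmod (x j) ^+ 2 <= V.

(** The conditional mean of g a (s j) given s i0 = a, for j != i0: s j is then uniform over the
    values other than a. *)
Definition offdiag_mean (a : T) : R[i] := (\sum_(l | l != a) g a l) / (#|T|.-1)%:R.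

Definition centered_sum (s : {perm T}) : R[i] :=
  \sum_(j in A) x j * (g (s i0) (s j) - offdiag_mean (s i0)).

Lemma centered_mgf_le (w : R[i]) (lam : R) : cmod w = 1 -> 0 <= lam ->
  \sum_(s : {perm T}) expR (lam * complex.Re (w * centered_sum s)) <=
  #|{perm T}|%:R * expR (10 * lam ^+ 2 * mu ^+ 2 * V).
Proof.
move=> w1 lam0.
pose h j a l := lam * complex.Re (w * (x j * (g a l - offdiag_mean a))).
(* Two off-diagonal entries of modulus at most mu differ by at most 2 mu. *)
pose c j := 2 * lam * mu * cmod (x j).
have mu0 := ltW mu_gt0.
have -> : \sum_(s : {perm T}) expR (lam * complex.Re (w * centered_sum s)) =
    \sum_(s : {perm T}) expR (\sum_(j <- enum A) h j (s i0) (s j)).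
  apply: eq_bigr => s _; congr expR.
  by rewrite big_enum /= mulr_sumr Re_sum mulr_sumr.
apply: (le_trans (@perm_mgf_le _ _ i0 (enum A) h c _ _ _ _ _)).
- by rewrite /= mem_enum i0A enum_uniq.
- by rewrite -cardE.
- by move=> j; rewrite !mulr_ge0 ?cmod_ge0.
- move=> j a; rewrite /h -mulr_sumr -Re_sum -!mulr_sumr sumrB sumr_const.
  rewrite cardC1 -[offdiag_mean a *+ _]mulr_natr divfK ?subrr ?mulr0 //.
  by rewrite pnatr_eq0; case: #|T| T_gt1 => [|[]].
- move=> j a l l' la l'a; rewrite /h -mulrBr -ReB -!mulrBr.
  rewrite normrM (ger0_norm lam0).
  have -> : c j = lam * (cmod (x j) * (2 * mu)) by rewrite /c; ring.
  rewrite ler_wpM2l // (le_trans (Re_le_cmod _)) // /cmod Normc.normcM -/(cmod w) w1.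
  rewrite mul1r Normc.normcM ler_wpM2l ?cmod_ge0 //.
  have -> : g a l - offdiag_mean a - (g a l' - offdiag_mean a) = g a l - g a l' by ring.
  by rewrite (le_trans (cmodB_le _ _)) // mulr_natl mulr2n lerD // g_mu.
rewrite ler_wpM2l // ler_expR -cardE big_enum /=.
have cardA' : (#|A| <= #|T|)%N by exact: max_card.
rewrite natrB //; set n : R := #|T|%:R; set k : R := #|A|%:R.
have k0 : 0 <= k by rewrite ler0n.
have kn : 8 * k <= n by rewrite -natrM ler_nat.
have n1 : 1 < n by rewrite ltr1n.
(* Hence the constant is at most 17/8 * 8/7 = 17/7 <= 10/4; the squared oscillations contribute the
   remaining factor 4 of the 10. *)
have nk : n / (n - k) <= 8 / 7 by rewrite ler_pdivrMr; lra.
have -> : \sum_(j in A) c j ^+ 2 = 4 * (lam * mu) ^+ 2 * \sum_(j in A) cmod (x j) ^+ 2.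
  by rewrite mulr_sumr; apply: eq_bigr => j _; rewrite /c; ring.
have := xV; set W := \sum_(j in A) _ => WV.
have W0 : 0 <= W by rewrite sumr_ge0 // => j _; rewrite sqr_ge0.
have -> : 10 * lam ^+ 2 * mu ^+ 2 * V = (10 / 4) * (4 * (lam * mu) ^+ 2 * V) by field.
apply: ler_pM.
- by rewrite mulr_ge0 ?divr_ge0 //; lra.
- by rewrite !mulr_ge0 ?sqr_ge0.
- lra.
by rewrite ler_wpM2l // mulr_ge0 ?sqr_ge0.
Qed.

(* Markov's inequality at the optimal lam, summed over the four directions w. *)
Lemma centered_tail (t : R) : 0 <= t ->
  #|[set s : {perm T} | t < cmod (centered_sum s)]|%:R <=
  4 * #|{perm T}|%:R * expR (- (t ^+ 2 / (80 * mu ^+ 2 * V))).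
Proof.
(* Passing to real parts costs the sqrt 2. This [lam] minimises 10 lam^2 mu^2 V - lam u, with
   minimum - u^2 / (40 mu^2 V) = - t^2 / (80 mu^2 V). *)
move=> t0; set u := t / Num.sqrt 2; set lam := u / (20 * mu ^+ 2 * V).
have u0 : 0 <= u by rewrite divr_ge0 // sqrtr_ge0.
have lam0 : 0 <= lam by rewrite divr_ge0 // !mulr_ge0 ?sqr_ge0 // ltW.
pose ws : seq R[i] := [:: 1; -1; 'i%C; - 'i%C].
have ws1 w : w \in ws -> cmod w = 1.
  by rewrite !inE => /or4P[] /eqP ->;
    rewrite /cmod /= ?oppr0 ?sqrrN ?expr0n ?expr1n ?addr0 ?add0r sqrtr1.
set bad := [set s | _].
have markov : #|bad|%:R * expR (lam * u) <=
    \sum_(w <- ws) \sum_(s : {perm T}) expR (lam * complex.Re (w * centered_sum s)).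
  rewrite exchange_big /= mulr_natl -sumr_const big_mkcond /=.
  apply: ler_sum => s _; case: ifP; last first.
    by move=> _; rewrite sumr_ge0 // => *; exact: expR_ge0.
  rewrite inE => /(cmod_gt_rotate t0)[w wws uw].
  rewrite (big_rem w) //= -[X in X <= _]addr0 lerD //.
    by rewrite ler_expR ler_wpM2l // ltW.
  by rewrite sumr_ge0 // => *; exact: expR_ge0.
rewrite -(ler_pM2r (expR_gt0 (lam * u))); apply: (le_trans markov).
apply: (@le_trans _ _
    (\sum_(w <- ws) #|{perm T}|%:R * expR (10 * lam ^+ 2 * mu ^+ 2 * V))).
  rewrite big_seq [leRHS]big_seq; apply: ler_sum => w /ws1 w1.
  exact: centered_mgf_le.
rewrite big_const_seq count_predT iter_addr_0 -[leLHS]mulr_natl.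
rewrite -[leRHS]mulrA -[leRHS]mulrA -expRD.
rewrite ler_pM2l // ler_wpM2l // ler_expR le_eqVlt; apply/orP; left; apply/eqP.
have -> : t ^+ 2 = 2 * u ^+ 2 by rewrite exprMn exprVn sqr_sqrtr //; field.
by rewrite /lam; field; rewrite !gt_eqF.
Qed.

End Tail.

(** * Gram matrix, energy defect and coherence *)

Section FrameAlgebra.
Variable R : realType.
Local Notation C := R[i].

Lemma sqr_l2norm m (v : 'cV[C]_m) : l2norm v ^+ 2 = \sum_k cmod (v k 0) ^+ 2.
Proof. by rewrite sqr_sqrtr // sumr_ge0 // => k _; exact: sqr_ge0. Qed.

Lemma l2norm_ge0 m (v : 'cV[C]_m) : 0 <= l2norm v.
Proof. exact: sqrtr_ge0. Qed.

Lemma cinnerE m (u v : 'cV[C]_m) : cinner u v = \sum_k u k 0 * conjc (v k 0).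
Proof. by rewrite /cinner dotmxE !mxE; apply: eq_bigr => k _; rewrite !mxE. Qed.

Lemma conj_cinner m (u v : 'cV[C]_m) : conjc (cinner u v) = cinner v u.
Proof.
rewrite !cinnerE rmorph_sum; apply: eq_bigr => k _.
by rewrite rmorphM /= conjcK mulrC.
Qed.

Lemma cinner_self m (v : 'cV[C]_m) : cinner v v = (l2norm v ^+ 2)%:C%C.
Proof.
by rewrite cinnerE sqr_l2norm rmorph_sum; apply: eq_bigr => k _; rewrite mulcJ.
Qed.

Lemma l2norm_row_perm N (s : 'S_N) (x : 'cV[C]_N) :
  l2norm (row_perm s x) = l2norm x.
Proof.
rewrite /l2norm; congr Num.sqrt; rewrite [RHS](reindex_inj (@perm_inj _ s)).
by apply: eq_bigr => k _; rewrite mxE.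
Qed.

Variables (M N : nat) (F : 'M[C]_(M, N)).

(** The second index is in the linear slot, matching the coefficient x j of [gram_row]. *)
Definition gram (a l : 'I_N) : C := cinner (col l F) (col a F).

Definition gram_row (x : 'cV[C]_N) (i : 'I_N) (t : 'S_N) : C :=
  \sum_(j | j != i) x j 0 * gram (t i) (t j).

(** Permuting the entries of x by s amounts to permuting the columns of F by the inverse of s; the
    square is then expanded. *)
Lemma sqr_l2norm_mul_row_perm (s : 'S_N) (x : 'cV[C]_N) :
  (l2norm (F *m row_perm s x) ^+ 2)%:C%C =
  \sum_i \sum_j conjc (x i 0) * (x j 0 * gram ((s^-1)%g i) ((s^-1)%g j)).
Proof.
set t := (s^-1)%g.
have Fx k : (F *m row_perm s x) k 0 = \sum_j F k (t j) * x j 0.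
  rewrite mxE [LHS](reindex_inj (@perm_inj _ t)).
  by apply: eq_bigr => j _; rewrite mxE permKV.
rewrite -cinner_self cinnerE; under eq_bigr do rewrite Fx rmorph_sum mulr_sumr.
rewrite exchange_big; apply: eq_bigr => i _.
under eq_bigr do rewrite mulr_suml.
rewrite exchange_big; apply: eq_bigr => j _.
rewrite /gram cinnerE !mulr_sumr; apply: eq_bigr => k _.
by rewrite !mxE rmorphM /=; ring.
Qed.

Hypothesis F_unit : forall i, l2norm (col i F) = 1.

(** Since the columns have norm 1, the diagonal terms of the expansion are |x_i|^2 and cancel
    against ||x||^2. *)
Lemma frame_defect (s : 'S_N) (x : 'cV[C]_N) :
  (l2norm (F *m row_perm s x) ^+ 2 - l2norm x ^+ 2)%:C%C =
  \sum_i conjc (x i 0) * gram_row x i (s^-1)%g.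
Proof.
rewrite rmorphB /= sqr_l2norm_mul_row_perm sqr_l2norm rmorph_sum -sumrB.
apply: eq_bigr => i _; rewrite (bigD1 i) //= /gram cinner_self F_unit expr1n.
rewrite mulr1 [conjc _ * x i 0]mulrC mulcJ addrAC subrr add0r.
by rewrite /gram_row mulr_sumr; apply: eq_bigr.
Qed.

Lemma worst_case_coherence_ge0 : 0 <= worst_case_coherence F.
Proof. by apply: bigmax_ge_id. Qed.

Lemma gram_le a l : l != a -> cmod (gram a l) <= worst_case_coherence F.
Proof.
by move=> la; apply: (@le_bigmax_cond _ _ _ (0 : R) (l, a) (fun ij => ij.1 != ij.2)
  (fun ij => cmod (cinner (col ij.1 F) (col ij.2 F)))).
Qed.

(** The sums in the average coherence are the conjugates of those in [offdiag_mean], and both are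
    divided by N - 1. *)
Lemma offdiag_mean_le a : (1 < N)%N ->
  cmod (offdiag_mean gram a) <= average_coherence F.
Proof.
move=> N1; rewrite /offdiag_mean /average_coherence card_ord.
have N0 : 0 < N%:R - 1 :> R by rewrite subr_gt0 ltr1n.
rewrite /cmod Normc.normcM mulrC Normc.normcV.
have -> : Normc.normc (N.-1%:R : C) = N%:R - 1.
  have -> : N.-1%:R = (N%:R - 1)%:C%C :> C.
    by rewrite -subn1 natrB 1?ltnW // rmorphB rmorph_nat rmorph1.
  by rewrite -/(cmod _) cmod_real gtr0_norm.
rewrite ler_pM2l ?invr_gt0 // -/(cmod _) -cmodJ rmorph_sum.
under eq_bigr => j _ do rewrite /= /gram conj_cinner.
exact: (@le_bigmax_cond _ _ _ (0 : R) a xpredT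
  (fun i => cmod (\sum_(j < N | j != i) cinner (col i F) (col j F)))).
Qed.

End FrameAlgebra.

(** Clears the denominator of an extended-real quotient; for m = 0, where the quotient may be
    infinite, the conclusion reads 0 <= b. *)
Lemma le_mul_of_ratio (R : realType) (m a b : R) : 0 <= m ->
  (a%:E <= b%:E / (100 * m ^+ 2)%:E)%E -> 0 <= b -> a * (100 * m ^+ 2) <= b.
Proof.
rewrite le_eqVlt => /predU1P[<- _|m0]; first by rewrite expr0n !mulr0.
have c0 : 0 < 100 * m ^+ 2 by rewrite mulr_gt0 ?exprn_gt0.
by rewrite inver gt_eqF // -EFinM lee_fin ler_pdivlMr.
Qed.

(** * Tail of one row sum and the deterministic reduction *)

Section WeakRIP.
Variables (R : realType) (M N K : nat) (F : 'M[R[i]]_(M, N)) (delta ell : R).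
Local Notation mu := (worst_case_coherence F).
Hypotheses (F_unit : forall i, l2norm (col i F) = 1)
  (nu_le : average_coherence F <= mu / Num.sqrt M%:R)
  (K_gt0 : (0 < K)%N) (delta_gt0 : 0 < delta) (N_gt1 : (1 < N)%N)
  (ell_ge4 : 4 <= ell) (K8 : (8 * K <= N)%N)
  (K_mu : 2 * K%:R * ell * (100 * mu ^+ 2) <= delta ^+ 2)
  (K_M : 2 * K%:R * ell <= M%:R).
Variable x : 'cV[R[i]]_N.
Hypothesis x_sparse : sparse K x.
Local Notation A := [set j : 'I_N | x j 0 != 0].
Local Notation X := (l2norm x).

Lemma sum_support_le : \sum_(j in A) cmod (x j 0) <= Num.sqrt K%:R * X.
Proof.
rewrite -ler_sqr ?nnegrE ?sumr_ge0 ?mulr_ge0 ?l2norm_ge0 ?sqrtr_ge0 //; last first.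
  by move=> *; exact: cmod_ge0.
apply: (le_trans (sqr_sum_le _ _)); rewrite exprMn sqr_sqrtr // sqr_l2norm.
apply: ler_pM => //; first by apply: sumr_ge0 => *; exact: sqr_ge0.
  by rewrite ler_nat.
by rewrite [leRHS](bigID (mem A)) /= lerDl sumr_ge0 // => *; exact: sqr_ge0.
Qed.

(** Here [ell] stands for ln N. With L = sqrt (2 ell), the bad event forces |S_i| > 10 L mu ||x||.
    The conditional mean accounts for at most L mu ||x|| / 8 of this, and [centered_tail] handles
    the remaining 79/8. *)
Lemma gram_row_tail (i : 'I_N) :
  #|[set t : 'S_N | delta * X < Num.sqrt K%:R * cmod (gram_row F x i t)]|%:R <=
    4 * #|{perm 'I_N}|%:R * expR (- (39 / 16 * ell)).
Proof.
have mu_ge0 : 0 <= mu by exact: worst_case_coherence_ge0.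
have X_ge0 : 0 <= X by exact: l2norm_ge0.
have rowE t : gram_row F x i t = \sum_(j in A :\ i) x j 0 * gram F (t i) (t j).
  rewrite /gram_row [LHS](bigID (mem A)) /= [X in _ + X]big1 ?addr0; last first.
    by move=> j /andP[_]; rewrite inE negbK => /eqP->; rewrite mul0r.
  by apply: eq_bigl => j; rewrite !inE.
(* [centered_tail] needs mu and ||x|| positive; otherwise every row sum vanishes and the bad event
   is empty. *)
have [muX|muX] := eqVneq (mu * X) 0.
  rewrite (_ : [set _ | _] = finset.set0) ?cards0 ?mulr_ge0 ?expR_ge0 //.
  apply/setP => t; rewrite !inE; apply/negbTE; rewrite -leNgt.
  suff -> : gram_row F x i t = 0.
    by rewrite /cmod Normc.normc0 mulr0 mulr_ge0 // ltW.
  move/eqP: muX; rewrite mulf_eq0 => /orP[/eqP mu0|/eqP X0].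
    apply: big1 => j ji; have := @gram_le _ _ _ F (t i) (t j).
    rewrite (inj_eq perm_inj) => /(_ ji); rewrite mu0 => g0.
    by rewrite (@Normc.eq0_normc _ (gram F (t i) (t j))) ?mulr0 //; apply/eqP;
      rewrite eq_le g0 cmod_ge0.
  apply: big1 => j _; suff -> : x j 0 = 0 by rewrite mul0r.
  have /eqP : X ^+ 2 = 0 by rewrite X0 expr0n.
  rewrite sqr_l2norm psumr_eq0 => [/allP/(_ j)|*]; last exact: sqr_ge0.
  by rewrite mem_index_enum sqrf_eq0 => /(_ isT)/eqP/Normc.eq0_normc.
have [mu_gt0 X_gt0] : 0 < mu /\ 0 < X.
  by move: muX; rewrite mulf_eq0 negb_or !lt0r mu_ge0 X_ge0 !andbT => /andP[].
pose k : R := Num.sqrt K%:R; pose L := Num.sqrt (2 * ell).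
have k_gt0 : 0 < k by rewrite sqrtr_gt0 ltr0n.
have k2 : k ^+ 2 = K%:R by rewrite sqr_sqrtr.
have ell_gt0 : 0 < ell by apply: lt_le_trans ell_ge4.
have L2 : L ^+ 2 = 2 * ell by rewrite sqr_sqrtr // mulr_ge0 // ltW.
have L_gt0 : 0 < L by rewrite sqrtr_gt0 mulr_gt0.
have kLM : k * L <= Num.sqrt M%:R.
  by rewrite -sqrtrM ?ler0n // ler_wsqrtr //; have := K_M; lra.
have kLdelta : k * (10 * L * mu) <= delta.
  rewrite -ler_sqr ?nnegrE ?mulr_ge0 ?(ltW k_gt0) ?(ltW L_gt0) ?(ltW delta_gt0) //.
  by rewrite !exprMn k2 L2; have := K_mu; lra.
pose Z := centered_sum i (A :\ i) (gram F) (fun j => x j 0).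
set thr := 79 / 8 * L * mu * X.
have thr_ge0 : 0 <= thr by rewrite !mulr_ge0 // ltW.
have sub : [set t : 'S_N | delta * X < k * cmod (gram_row F x i t)] \subset
    [set t : 'S_N | thr < cmod (Z t)].
  apply/fintype.subsetP => t; rewrite !inE => bad.
  have split : gram_row F x i t =
      Z t + offdiag_mean (gram F) (t i) * \sum_(j in A :\ i) x j 0.
    rewrite rowE /Z /centered_sum mulr_sumr -big_split /=.
    by apply: eq_bigr => j _; ring.
  have mean_le : cmod (offdiag_mean (gram F) (t i) * \sum_(j in A :\ i) x j 0) <=
      mu / (k * L) * (k * X).
    rewrite /cmod Normc.normcM; apply: ler_pM; rewrite ?cmod_ge0 //.
      apply: (le_trans (offdiag_mean_le _ _ N_gt1)); apply: (le_trans nu_le).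
      rewrite ler_wpM2l // lef_pV2 // posrE ?mulr_gt0 //.
      by rewrite (lt_le_trans _ kLM) // mulr_gt0.
    apply: le_trans (cmod_sum_le _ _ _) _; apply: le_trans sum_support_le.
    rewrite [leRHS](bigID (pred1 i)) /= addrC -[leLHS]addr0 lerD ?sumr_ge0 //.
      rewrite le_eqVlt; apply/orP; left; apply/eqP.
      by apply: eq_bigl => j; rewrite !inE andbC.
    by move=> *; exact: cmod_ge0.
  (* The 1/8 comes from L ^ 2 = 2 ell >= 8. *)
  have mean_le2 : mu / (k * L) * (k * X) <= mu * X * L / 8.
    have -> : mu / (k * L) * (k * X) = mu * X / L by field; rewrite !gt_eqF.
    rewrite ler_pdivrMr // (_ : _ * L = mu * X * L ^+ 2 / 8); last by ring.
    rewrite L2; have := mulr_gt0 mu_gt0 X_gt0; have := ell_ge4; nra.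
  have tri : cmod (gram_row F x i t) <= cmod (Z t) + mu * X * L / 8.
    rewrite split; apply: (le_trans (le_normcD _ _)); rewrite lerD2l.
    exact: le_trans mean_le2.
  have : k * (10 * L * mu * X) < k * (cmod (Z t) + mu * X * L / 8).
    apply: (@lt_le_trans _ _ (k * cmod (gram_row F x i t))).
      by apply: le_lt_trans bad; rewrite mulrA ler_wpM2r.
    by rewrite ler_pM2l.
  by rewrite ltr_pM2l // /thr; lra.
apply: (@le_trans _ _ #|[set t : 'S_N | thr < cmod (Z t)]|%:R).
  by rewrite ler_nat subset_leq_card.
have cardA : (#|A :\ i| <= K)%N.
  by apply: leq_trans x_sparse; apply: subset_leq_card; exact: finset.subsetDl.
apply: (le_trans (@centered_tail R _ i (A :\ i) (gram F) _ mu (X ^+ 2)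
  _ _ _ _ _ _ _ _ _)).
- by rewrite !inE eqxx.
- by rewrite card_ord (leq_trans _ K8) // leq_mul2l cardA.
- by rewrite card_ord.
- by move=> a l; exact: gram_le.
- by [].
- by rewrite exprn_gt0.
- rewrite sqr_l2norm [leRHS](bigID (mem (A :\ i))) /= lerDl.
  by apply: sumr_ge0 => *; exact: sqr_ge0.
- by [].
rewrite ler_wpM2l ?mulr_ge0 // ler_expR lerN2.
(* As L ^ 2 = 2 ell, this equals 6241/2560 ell, just above 39/16 ell = 6240/2560 ell. *)
have -> : thr ^+ 2 / (80 * mu ^+ 2 * X ^+ 2) = (79 / 8) ^+ 2 / 80 * L ^+ 2.
  by rewrite /thr; field; rewrite !gt_eqF.
by rewrite L2; have := ell_ge4; lra.
Qed.

(** Each |x_i| |S_i| is at most |x_i| delta ||x|| / sqrt K, and the |x_i| sum to at most sqrt K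
    ||x||. *)
Lemma rip_defect_le (s : 'S_N) :
  (forall i, i \in A -> Num.sqrt K%:R * cmod (gram_row F x i (s^-1)%g) <= delta * X) ->
  `|l2norm (F *m row_perm s x) ^+ 2 - X ^+ 2| <= delta * X ^+ 2.
Proof.
move=> good; rewrite -cmod_real frame_defect //.
have k_gt0 : 0 < Num.sqrt K%:R :> R by rewrite sqrtr_gt0 ltr0n.
rewrite -(ler_pM2l k_gt0).
apply: (@le_trans _ _ (\sum_(i in A) cmod (x i 0) * (delta * X))).
  rewrite (bigID (mem A)) /= [X in _ + X]big1 ?addr0; last first.
    by move=> j; rewrite inE negbK => /eqP->; rewrite conjc0 mul0r.
  apply: (le_trans (ler_wpM2l (ltW k_gt0) (cmod_sum_le _ _ _))).
  rewrite mulr_sumr; apply: ler_sum => i iA.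
  rewrite {1}/cmod Normc.normcM -/(cmod _) -/(cmod _) cmodJ mulrCA.
  by rewrite ler_wpM2l ?cmod_ge0 // good.
rewrite -mulr_suml; apply: (le_trans (ler_wpM2r _ sum_support_le)).
  by rewrite mulr_ge0 ?l2norm_ge0 // ltW.
by rewrite le_eqVlt; apply/orP; left; apply/eqP; ring.
Qed.

End WeakRIP.

(** * Union bound over the support *)

Unset Implicit Arguments.
Set Strict Implicit.

(* The quotient by 100 * mu_F ^ 2 is taken in the extended reals, where
   0^-1 = +oo, so that the minimum is M when mu_F = 0. *)
Theorem theorem14 (R : realType) (M N K : nat) (F : 'M[R[i]]_(M, N)) (delta : R)
    (F_frame : unit_norm_frame F)
    (F_coherence : strong_coherence_property F)
    (K_gt0 : (0 < K)%N) (delta_gt0 : 0 < delta)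
    (N_ge128 : (128 <= N)%N)
    (K_bound : ((2 * K%:R * ln (N%:R : R))%:E <=
       Order.min ((delta ^+ 2)%:E / (100 * worst_case_coherence F ^+ 2)%:E)
                 (M%:R)%:E)%E) :
  weak_RIP K delta (4 * K%:R / N%:R ^+ 2) F.
Proof.
have [rankF F_unit] := F_frame; have [_ nu_le] := F_coherence.
have ell_ge4 : 4 <= ln (N%:R : R).
  apply: le_trans (ln128_ge4 R) _.
  by rewrite ler_ln ?posrE ?ltr0n ?ler_nat // (leq_trans _ N_ge128).
have MN : (M <= N)%N by rewrite -rankF; exact: rank_leq_col.
have N_gt1 : (1 < N)%N by exact: leq_trans N_ge128.
have N0 : 0 < N%:R :> R by rewrite ltr0n ltnW.
move: K_bound; rewrite le_min lee_fin => /andP[K_mu K_M].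
have {}K_mu := le_mul_of_ratio (worst_case_coherence_ge0 F) K_mu (sqr_ge0 delta).
(* The chain is 8 K <= 2 K ln N <= M <= N, with M <= N because F has rank M. *)
have K8 : (8 * K <= N)%N.
  rewrite -(ler_nat R); apply: (@le_trans _ _ M%:R); last by rewrite ler_nat.
  apply: le_trans K_M; rewrite natrM mulrAC ler_wpM2r //; lra.
(* As 39/16 > 2, this bound is strict, which makes the final probability strictly exceed 1 - p. *)
have [e eE e_lt] : exists2 e, e = expR (- (39 / 16 * ln (N%:R : R))) & e < (N%:R ^+ 2)^-1.
  exists (expR (- (39 / 16 * ln (N%:R : R)))) => //.
  have -> : (N%:R ^+ 2)^-1 = expR (- (2 * ln (N%:R : R))).
    by rewrite expRN expRM_natl lnK ?posrE.
  by rewrite ltr_expR; lra.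
move=> x x_sparse; rewrite /uniform_perm_prob.
set G := finset _; set A := [set j : 'I_N | x j 0 != 0].
pose B i := [set t : 'S_N | delta * l2norm x <
  Num.sqrt K%:R * cmod (gram_row F x i t)].
(* The events [B i] concern the inverse of s; inversion is injective, so the preimages have the same
   cardinality. *)
have badG : ~: G \subset \bigcup_(i in A) (invg @^-1: B i).
  apply/fintype.subsetP => s; rewrite inE; apply: contraR => sB.
  rewrite inE /= l2norm_row_perm.
  suff : `|l2norm (F *m row_perm s x) ^+ 2 - l2norm x ^+ 2| <= delta * l2norm x ^+ 2.
    by rewrite ler_norml => /andP[? ?]; apply/andP; split; lra.
  apply: (rip_defect_le F_unit K_gt0 delta_gt0 x_sparse) => i iA.
  rewrite leNgt; apply: contra sB => sB; apply/finset.bigcupP.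
  by exists i => //; rewrite !inE.
have P0 : 0 < #|{perm 'I_N}|%:R :> R.
  by rewrite ltr0n; apply/card_gt0P; exists 1%g.
have card_bad : #|~: G|%:R <= K%:R * (4 * #|{perm 'I_N}|%:R * e).
  apply: (@le_trans _ _ (\sum_(i in A) #|B i|%:R)).
    rewrite -natr_sum ler_nat; apply: leq_trans (subset_leq_card badG) _.
    apply: leq_trans (card_big_setU _ _ _) _.
    by apply: leq_sum => i _; rewrite card_preimset //; exact: invg_inj.
  apply: (@le_trans _ _ (\sum_(i in A) (4 * #|{perm 'I_N}|%:R * e))).
    apply: ler_sum => i _.
    rewrite eE; exact: (gram_row_tail nu_le K_gt0 delta_gt0 N_gt1 ell_ge4 K8
      K_mu K_M x_sparse).
  rewrite sumr_const -[leLHS]mulr_natl ler_wpM2r ?ler_nat //.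
  by rewrite !mulr_ge0 ?eE ?expR_ge0 // ltW.
have cardG : #|G|%:R = #|{perm 'I_N}|%:R - #|~: G|%:R :> R.
  by rewrite -(cardsC G) natrD addrK.
rewrite cardsT ltr_pdivlMr // cardG.
have : K%:R * (4 * #|{perm 'I_N}|%:R * e) <
    K%:R * (4 * #|{perm 'I_N}|%:R * (N%:R ^+ 2)^-1).
  by rewrite ltr_pM2l ?ltr0n // ltr_pM2l // mulr_gt0.
move: card_bad; clear; lra.
Qed.
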